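(* Let $(N_1,C_1)$ and $(N_2,C_2)$ be coherent nets and $E$ a Presburger formula with free variables in $P_1\cup P_2$, and suppose $(N_1,C_1)\approxeq_E(N_2,C_2)$. Then the silent reachability set $R_\tau(N_1,C_1)\triangleq\{m'\in\mathbb N^{P_1}\mid \exists m\models C_1.\ m\xRightarrow{\epsilon}m'\}$ is Presburger-definable, i.e. there is a Presburger formula over the places of $N_1$ whose set of models in $\mathbb N^{P_1}$ is exactly $R_\tau(N_1,C_1)$.
   Context: A labeled Petri net $N=(P,T,\mathrm{Pre},\mathrm{Post})$ has finite place set $P$, finite transition set $T$, $\mathrm{Pre},\mathrm{Post}:T\to(P\to\mathbb N)$ and labeling $l:T\to\Sigma\cup\{\tau\}$ with $\tau\notin\Sigma$ silent. A marking is $m:P\to\mathbb N$. $t$ is enabled at $m$ if $m(p)\ge\mathrm{Pre}(t,p)$ for all $p$, and then $m\xrightarrow{t}m'$ with $m'=m-\mathrm{Pre}(t)+\mathrm{Post}(t)$; $m\xRightarrow{\varrho}m'$ is firing along $\varrho\in T^*$. Extend $l$ to $T^*$ by erasing $\tau$. For $\sigma\in\Sigma^*$, $m\xRightarrow{\sigma}m'$ means some $\varrho$ with $l(\varrho)=\sigma$ has $m\xRightarrow{\varrho}m'$ (so $m\xRightarrow{\epsilon}m'$ means reachability using only silent transitions). $m\overset{\epsilon}{\twoheadrightarrow}m'$ iff $m=m'$; for $\sigma\in\Sigma^*,a\in\Sigma$, $m\overset{\sigma a}{\twoheadrightarrow}m'$ iff there exist $m''$, $t$ with $l(t)=a$ and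 $m\xRightarrow{\sigma}m''\xrightarrow{t}m'$. For a Presburger formula $C$ over the places of $N$, $(N,C)$ is a coherent net if for every $m\models C$, $\sigma\in\Sigma^*$, $m\xRightarrow{\sigma}m'$ there is $m''\models C$ with $m\overset{\sigma}{\twoheadrightarrow}m''$ and $m''\xRightarrow{\epsilon}m'$. For markings $m_1\in\mathbb N^{P_1}$, $m_2\in\mathbb N^{P_2}$ (place sets may share places): $m_1\equiv_E m_2$ means they agree on $P_1\cap P_2$ and $m_1\cup m_2$ satisfies $E$ over $\mathbb N$; $m_1\langle C_1EC_2\rangle m_2$ means $m_1\models C_1$, $m_1\equiv_E m_2$, $m_2\models C_2$. $(N_1,C_1)\preceq_E(N_2,C_2)$ means: (S1) for every $m_1\models C_1$ there is $m_2$ with $m_1\langle C_1EC_2\rangle m_2$; (S2) for all $m_1\xRightarrow{\epsilon}m_1'$ in $N_1$ and all $m_2$, $m_1\equiv_E m_2$ implies $m_1'\equiv_E m_2$; (S3) for all $\sigma\in\Sigma^*$, $m_1\xRightarrow{\sigma}m_1'$ in $N_1$ and $m_2,m_2'$ with $m_1\langle C_1EC_2\rangle m_2$ and $m_1'\equiv_E m_2'$, we have $m_2\xRightarrow{\sigma}m_2'$ in $N_2$. $(N_1,C_1)\approxeq_E(N_2,C_2)$ means $(N_1,C_1)\preceq_E(N_2,C_2)$ and $(N_2,C_2)\preceq_E(N_1,C_1)$ (the latter with the roles of the two nets exchanged, using the same $E$). *)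

(* Defs.v *)
From HB Require Import structures.
From mathcomp Require Export all_boot finmap.

Set Implicit Arguments.
Unset Strict Implicit.
Unset Printing Implicit Defensive.

Local Open Scope nat_scope.

(* First-order formulas over (nat, 0, 1, +, =, <=). The formulas in pform X are
   those whose free variables belong to X; a quantifier binds the variable None
   of its body, and the outer variables x appear there as Some x. *)

Inductive pterm (X : Type) : Type :=
| PVar of X
| PZero
| POne
| PAdd of pterm X & pterm X.

Arguments PZero {X}.
Arguments POne {X}.

Inductive pform (X : Type) : Type :=
| PEq of pterm X & pterm X
| PLe of pterm X & pterm X
| PNot of pform X
| PAnd of pform X & pform X
| POr of pform X & pform X
| PExists of pform (option X)
| PForall of pform (option X).

Fixpoint pval (X : Type) (v : X -> nat) (t : pterm X) : nat :=
  match t with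
  | PVar x => v x
  | PZero => 0
  | POne => 1
  | PAdd t1 t2 => pval v t1 + pval v t2
  end.

Fixpoint sat (X : Type) (v : X -> nat) (F : pform X) {struct F} : Prop :=
  match F with
  | PEq t1 t2 => pval v t1 = pval v t2
  | PLe t1 t2 => pval v t1 <= pval v t2
  | PNot G => ~ sat v G
  | PAnd G H => sat v G /\ sat v H
  | POr G H => sat v G \/ sat v H
  | PExists G => exists n : nat, sat (oapp v n) G
  | PForall G => forall n : nat, sat (oapp v n) G
  end.

(* Place sets are finite subsets of a common type V of place names, so that two
   nets may share places. The label None is the silent label tau. *)

Record lpn (V : choiceType) (Sigma : Type) : Type := Lpn {
  places : {fset V};
  trans : finType;
  pre : trans -> {ffun places -> nat};
  post : trans -> {ffun places -> nat};
  label : trans -> option Sigma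
}.

Definition marking (V : choiceType) (Sigma : Type) (N : lpn V Sigma) : Type :=
  {ffun places N -> nat}.

Section Nets.

Variables (V : choiceType) (Sigma : Type).
Implicit Type N : lpn V Sigma.

Definition enabled N (m : marking N) (t : trans N) : Prop :=
  forall p : places N, pre t p <= m p.

Definition fire N (m : marking N) (t : trans N) (m' : marking N) : Prop :=
  enabled m t /\ m' = [ffun p => m p - pre t p + post t p].

Fixpoint fire_seq N (m : marking N) (rho : seq (trans N)) (m' : marking N) :
    Prop :=
  if rho is t :: rho' then
    exists2 m1 : marking N, fire m t m1 & fire_seq m1 rho' m'
  else m = m'.

(* pmap erases the silent label None. *)
Definition label_seq N (rho : seq (trans N)) : seq Sigma :=
  pmap (@label V Sigma N) rho.

Definition weak_step N (m : marking N) (s : seq Sigma) (m' : marking N) : Prop :=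
  exists2 rho : seq (trans N), label_seq rho = s & fire_seq m rho m'.

(* The two-headed arrow: a weak step that does not end with a silent
   transition. *)
Inductive strict_step N (m : marking N) : seq Sigma -> marking N -> Prop :=
| StrictNil : strict_step m [::] m
| StrictRcons (s : seq Sigma) (a : Sigma) (m'' m' : marking N) (t : trans N) :
    label t = Some a -> weak_step m s m'' -> fire m'' t m' ->
    strict_step m (rcons s a) m'.

Definition coherent N (C : pform (places N)) : Prop :=
  forall (m : marking N) (s : seq Sigma) (m' : marking N),
    sat m C -> weak_step m s m' ->
    exists m'' : marking N,
      [/\ sat m'' C, strict_step m s m'' & weak_step m'' [::] m'].

(* The union of two markings that agree on the shared places; the value 0 is
   only taken outside of the two place sets. *)
Definition marking_union N1 N2 (m1 : marking N1) (m2 : marking N2) (x : V) :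
    nat :=
  if insub x is Some p1 then m1 p1
  else if insub x is Some p2 then m2 p2 else 0.

(* U stands for the set of places of the two nets. It is left abstract so that
   the same E can be used when the two nets are exchanged: P1 `|` P2 and
   P2 `|` P1 are equal but not convertible. *)
Definition equivE (U : {fset V}) (E : pform U) N1 N2
    (m1 : marking N1) (m2 : marking N2) : Prop :=
  (forall (p1 : places N1) (p2 : places N2), val p1 = val p2 -> m1 p1 = m2 p2)
  /\ sat (fun p : U => marking_union m1 m2 (val p)) E.

Definition compatE (U : {fset V}) (E : pform U) N1 N2
    (C1 : pform (places N1)) (C2 : pform (places N2))
    (m1 : marking N1) (m2 : marking N2) : Prop :=
  [/\ sat m1 C1, equivE E m1 m2 & sat m2 C2].

Definition abstractsE (U : {fset V}) (E : pform U) N1 N2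
    (C1 : pform (places N1)) (C2 : pform (places N2)) : Prop :=
  [/\ forall m1 : marking N1, sat m1 C1 ->
        exists m2 : marking N2, compatE E C1 C2 m1 m2,
      forall (m1 m1' : marking N1) (m2 : marking N2),
        weak_step m1 [::] m1' -> equivE E m1 m2 -> equivE E m1' m2
    & forall (s : seq Sigma) (m1 m1' : marking N1) (m2 m2' : marking N2),
        weak_step m1 s m1' -> compatE E C1 C2 m1 m2 -> equivE E m1' m2' ->
        weak_step m2 s m2'].

Definition equiv_netsE (U : {fset V}) (E : pform U) N1 N2
    (C1 : pform (places N1)) (C2 : pform (places N2)) : Prop :=
  abstractsE E C1 C2 /\ abstractsE E C2 C1.

Definition silent_reach N (C : pform (places N)) (m' : marking N) : Prop :=
  exists2 m : marking N, sat m C & weak_step m [::] m'.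

Definition presburger_definable N (S : marking N -> Prop) : Prop :=
  exists F : pform (places N), forall m : marking N, sat m F <-> S m.

End Nets.

(* Main.v *)
(** The silent reachability set of [(N1, C1)] is the set of markings [m'] with
    [m' ==_E m2] for some [m2] satisfying [C2]. If [m |= C1] silently reaches [m'],
    then (S1) gives such an [m2] for [m], and (S2) carries the equivalence over to
    [m']. Conversely, (S1) from [N2] to [N1] gives [m1 |= C1] with [m2 ==_E m1],
    and (S3) applied to the empty run of [N2] at [m2] yields a silent run from [m1]
    to [m']. As place sets are finite, the existential quantification over [m2]
    is a block of first-order quantifiers. *)
Require Import Defs.
From mathcomp Require Import all_boot finmap.

Set Implicit Arguments.
Unset Strict Implicit.
Unset Printing Implicit Defensive.

Local Open Scope fset_scope.

Fixpoint tsubst (X Y : Type) (f : X -> pterm Y) (t : pterm X) : pterm Y :=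
  match t with
  | PVar x => f x
  | PZero => PZero
  | POne => POne
  | PAdd t1 t2 => PAdd (tsubst f t1) (tsubst f t2)
  end.

(** Substitution under a binder: the bound variable [None] is kept, and the variables of each [f x]
    are shifted by [Some] to avoid capture. *)
Definition lift_subst (X Y : Type) (f : X -> pterm Y) :
    option X -> pterm (option Y) :=
  oapp (fun x => tsubst (fun y => PVar (Some y)) (f x)) (PVar None).

Fixpoint psubst (X Y : Type) (f : X -> pterm Y) (F : pform X) : pform Y :=
  match F with
  | PEq t1 t2 => PEq (tsubst f t1) (tsubst f t2)
  | PLe t1 t2 => PLe (tsubst f t1) (tsubst f t2)
  | PNot G => PNot (psubst f G)
  | PAnd G H => PAnd (psubst f G) (psubst f H)
  | POr G H => POr (psubst f G) (psubst f H)
  | PExists G => PExists (psubst (lift_subst f) G)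
  | PForall G => PForall (psubst (lift_subst f) G)
  end.

Lemma pval_tsubst (X Y : Type) (f : X -> pterm Y) (v : Y -> nat)
    (w : X -> nat) (t : pterm X) :
  (forall x, pval v (f x) = w x) -> pval v (tsubst f t) = pval w t.
Proof. by move=> vf; elim: t => //= t1 -> t2 ->. Qed.

Lemma pval_lift_subst (X Y : Type) (f : X -> pterm Y) (v : Y -> nat)
    (w : X -> nat) (n : nat) :
  (forall x, pval v (f x) = w x) ->
  forall o, pval (oapp v n) (lift_subst f o) = oapp w n o.
Proof. by move=> vf [x|] //=; rewrite -vf; apply: pval_tsubst. Qed.

(** Asking only for pointwise equality with [w] lets the quantifier cases go through without
    functional extensionality. The induction generalizes over [Y], [f], [v] and [w] because a binder
    changes the variable types. *)
Lemma sat_psubst (X Y : Type) (f : X -> pterm Y) (v : Y -> nat)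
    (w : X -> nat) (F : pform X) :
  (forall x, pval v (f x) = w x) -> sat v (psubst f F) <-> sat w F.
Proof.
elim: F Y f v w => {X} [X t1 t2|X t1 t2|X G IHG|X G IHG H IHH|X G IHG H IHH
  |X G IHG|X G IHG] Y f v w vf /=.
- by rewrite !(pval_tsubst _ vf).
- by rewrite !(pval_tsubst _ vf).
- by have := IHG _ _ _ _ vf; tauto.
- by have := IHG _ _ _ _ vf; have := IHH _ _ _ _ vf; tauto.
- by have := IHG _ _ _ _ vf; have := IHH _ _ _ _ vf; tauto.
- by split=> -[n Gn]; exists n; apply/(IHG _ _ _ _ (pval_lift_subst n vf)).
- by split=> Gn n; apply/(IHG _ _ _ _ (pval_lift_subst n vf)).
Qed.

(** The identity substitution, evaluated under [v], matches both [v] and [w]. *)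
Lemma eq_sat (X : Type) (v w : X -> nat) (F : pform X) :
  v =1 w -> sat v F <-> sat w F.
Proof.
move=> vw; rewrite -(sat_psubst (f := @PVar X) (v := v) F vw).
by apply: iff_sym; apply: sat_psubst.
Qed.

Definition sum_val (X Y : Type) (v : X -> nat) (w : Y -> nat) (z : X + Y) : nat :=
  match z with inl x => v x | inr y => w y end.

(** One quantifier is added per index: [ord0] becomes the bound variable [None], and the other [n]
    indices are eliminated first, over [option X]. *)
Lemma exists_ord_definable (n : nat) (X : Type) (G : pform (X + 'I_n)) :
  exists F : pform X, forall v : X -> nat,
    sat v F <-> exists w : 'I_n -> nat, sat (sum_val v w) G.
Proof.
elim: n X G => [|n IHn] X G.
  pose f (z : X + 'I_0) := match z with inl x => PVar x | inr _ => PZero end.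
  have fP v w : sat v (psubst f G) <-> sat (sum_val v w) G.
    by apply: sat_psubst => -[x|[]].
  exists (psubst f G) => v; split=> [Gv|[w /fP]//].
  by exists (fun=> 0); apply/fP.
pose f (z : X + 'I_n.+1) : pterm (option X + 'I_n) :=
  match z with
  | inl x => PVar (inl (Some x))
  | inr i => PVar (if unlift ord0 i is Some j then inr j else inl None)
  end.
have [F FP] := IHn _ (psubst f G); exists (PExists F) => v.
have fE k (w : 'I_n -> nat) z :
    pval (sum_val (oapp v k) w) (f z)
    = sum_val v (fun i => oapp w k (unlift ord0 i)) z.
  by case: z => [x|i] //=; case: unlift.
split=> [[k /FP[w Gw]]|[w Gw]].
  by exists (fun i => oapp w k (unlift ord0 i)); apply/(sat_psubst _ (fE k w)).
exists (w ord0); apply/FP; exists (w \o lift ord0).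
(* Splitting [w] at [ord0] and gluing it back gives [w] only pointwise. *)
apply/(sat_psubst _ (fE _ _)); apply: (iffLR (eq_sat G _) Gw) => -[x|i] //=.
by case: unliftP => [j|] ->.
Qed.

(** Renaming along [enum_rank] reduces [Y] to an ordinal. *)
Lemma exists_ffun_definable (X : Type) (Y : finType) (G : pform (X + Y)) :
  exists F : pform X, forall v : X -> nat,
    sat v F <-> exists w : {ffun Y -> nat}, sat (sum_val v w) G.
Proof.
pose f (z : X + Y) : pterm (X + 'I_#|Y|) :=
  PVar (match z with inl x => inl x | inr y => inr (enum_rank y) end).
have [F FP] := exists_ord_definable (psubst f G); exists F => v.
split=> [/FP[w Gw]|[w Gw]].
  exists [ffun y => w (enum_rank y)]; apply: (iffLR (sat_psubst G _) Gw) => -[x|y] //=.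
  by rewrite ffunE.
apply/FP; exists (w \o enum_val); apply: (iffRL (sat_psubst G _) Gw) => -[x|y] //=.
by rewrite enum_rankK.
Qed.

Definition pconj (X : Type) : seq (pform X) -> pform X :=
  foldr (@PAnd X) (PEq PZero PZero).

Lemma sat_pconj (X : Type) (I : eqType) (v : X -> nat) (G : I -> pform X)
    (s : seq I) :
  sat v (pconj (map G s)) <-> forall i, i \in s -> sat v (G i).
Proof.
elim: s => [|i s IHs] //=; split=> [[Gi /IHs Gs] j|Gs].
  by rewrite inE => /predU1P[->|/Gs].
split; first by apply: Gs; rewrite mem_head.
by apply/IHs => j js; apply: Gs; rewrite inE js orbT.
Qed.

Section EquivFormula.

Variables (V : choiceType) (Sigma : Type).
Implicit Types N : lpn V Sigma.

(** Exchanging the nets changes which marking is looked up first, which matters only at shared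
    places, where the two agree. *)
Lemma equivE_sym (U : {fset V}) (E : pform U) N1 N2
    (m1 : marking N1) (m2 : marking N2) :
  equivE E m1 m2 -> equivE E m2 m1.
Proof.
move=> [agree Em]; split=> [p2 p1 eq_p|]; first by rewrite (agree p1 p2).
apply: (iffLR (eq_sat E _) Em) => x; rewrite /marking_union.
case: insubP => [p1 _ p1E|_]; case: insubP => [p2 _ p2E|_] //.
by rewrite (agree p1 p2) // p1E p2E.
Qed.

(** Syntactic counterpart of [marking_union], with the same lookup order and default. *)
Definition union_term N1 N2 (x : V) : pterm (places N1 + places N2) :=
  if insub x is Some p1 then PVar (inl p1)
  else if insub x is Some p2 then PVar (inr p2) else PZero.

Lemma pval_union_term N1 N2 (m1 : marking N1) (m2 : marking N2) (x : V) :
  pval (sum_val m1 m2) (union_term N1 N2 x) = marking_union m1 m2 x.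
Proof.
by rewrite /union_term /marking_union; case: insubP => //= _; case: insubP.
Qed.

(** A shared place occurs as two variables, one per net; the finite conjunction equates them. *)
Definition equiv_form (U : {fset V}) (E : pform U) N1 N2 :
    pform (places N1 + places N2) :=
  PAnd (pconj [seq PEq (PVar (inl p.1)) (PVar (inr p.2))
              | p : places N1 * places N2 <- enum [pred p | val p.1 == val p.2]])
       (psubst (fun x : U => union_term N1 N2 (val x)) E).

Lemma sat_equiv_form (U : {fset V}) (E : pform U) N1 N2
    (m1 : marking N1) (m2 : marking N2) :
  sat (sum_val m1 m2) (equiv_form E N1 N2) <-> equivE E m1 m2.
Proof.
have EE := sat_psubst E (fun x : U => pval_union_term m1 m2 (val x)).
rewrite /equiv_form /=; split=> [[/sat_pconj agree /EE Em]|[agree /EE Em]].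
  split=> // p1 p2 eq_p; apply: (agree (p1, p2)).
  by rewrite mem_enum inE /= eq_p.
split=> //; apply/sat_pconj => -[p1 p2]; rewrite mem_enum inE /= => /eqP.
exact: agree.
Qed.

Lemma exists_equivE_definable (U : {fset V}) (E : pform U) N1 N2
    (C2 : pform (places N2)) :
  presburger_definable
    (fun m1 : marking N1 =>
       exists2 m2 : marking N2, sat m2 C2 & equivE E m1 m2).
Proof.
pose C2' := psubst (fun p => PVar (inr p)) C2 : pform (places N1 + places N2).
have C2'P (m1 : marking N1) (m2 : marking N2) :
    sat (sum_val m1 m2) C2' <-> sat m2 C2 by exact: sat_psubst.
have [F FP] := exists_ffun_definable (PAnd C2' (equiv_form E N1 N2)).
exists F => m1; split=> [/FP[m2 [/C2'P Cm2 /sat_equiv_form Em]]|].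
  by exists m2.
by move=> [m2 Cm2 Em]; apply/FP; exists m2; split;
  [apply/C2'P | apply/sat_equiv_form].
Qed.

Lemma silent_reachP (U : {fset V}) (E : pform U) N1 N2
    (C1 : pform (places N1)) (C2 : pform (places N2)) (m : marking N1) :
  equiv_netsE E C1 C2 ->
  (exists2 m2 : marking N2, sat m2 C2 & equivE E m m2) <-> silent_reach C1 m.
Proof.
move=> [[S1 S2 _] [S1' _ S3']]; split=> [[m2 Cm2 Em]|[m1 Cm1 m1m]].
  have [m1 m2m1] := S1' _ Cm2; have [_ _ Cm1] := m2m1.
  (* The run of [N2] stays at [m2], which is equivalent to both [m1] and [m]. *)
  exists m1 => //; apply: S3' m2m1 (equivE_sym Em).
  by exists [::].
have [m2 [_ Em Cm2]] := S1 _ Cm1.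
by exists m2 => //; apply: S2 m1m Em.
Qed.

End EquivFormula.

Theorem theorem6 (V : choiceType) (Sigma : Type) (N1 N2 : lpn V Sigma)
    (C1 : pform (places N1)) (C2 : pform (places N2))
    (E : pform (places N1 `|` places N2)) :
  coherent C1 -> coherent C2 -> equiv_netsE E C1 C2 ->
  presburger_definable (silent_reach C1).
Proof.
move=> _ _ eqN; have [F FP] := exists_equivE_definable E N1 C2.
by exists F => m; split=> [/FP/(silent_reachP _ eqN)|/(silent_reachP _ eqN)/FP].
Qed.
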